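(* Let $p$ be an odd prime and $r\ge 1$ an integer. For $n\ge 4$ consider the authentication code with source states $\mathbb{F}_{p^n}$, keys $\mathbb{F}_{p^n}$, messages $\mathbb{F}_{p^n}\times\mathbb{F}_p$ and encoding rules $E_k(s)=(s+k^{p^r},\operatorname{Tr}(sk))$. Then $P_I$ asymptotically meets the information-theoretic lower bound $P_I\ge 2^{H(\mathscr{E}|\mathscr{M})-H(\mathscr{E})}$, i.e. $$\lim_{n\to\infty}\frac{2^{H(\mathscr{E}|\mathscr{M})-H(\mathscr{E})}}{P_I}=1 .$$
   Context: $\operatorname{Tr}$ is the absolute trace from $\mathbb{F}_{p^n}$ to $\mathbb{F}_p$. The source state $s\in\mathbb{F}_{p^n}$ and the key $k\in\mathbb{F}_{p^n}$ are independent and uniformly distributed. $\mathscr{E}$ denotes the random encoding rule $E_k$, $\mathscr{M}$ the random message $E_k(s)=(s+k^{p^r},\operatorname{Tr}(sk))$; $H(\mathscr{E})$ is the Shannon entropy and $H(\mathscr{E}|\mathscr{M})$ the conditional Shannon entropy, measured in bits (logarithms base 2). The receiver holding key $k$ accepts a message $(m_1,m_2)$ iff $\operatorname{Tr}((m_1-k^{p^r})k)=m_2$, and the maximum success probability of impersonation attack is $$P_I=\max_{a\in\mathbb{F}_{p^n},\,b\in\mathbb{F}_p}\frac{|\{x\in\mathbb{F}_{p^n}:\operatorname{Tr}(ax-x^{p^r+1})=b\}|}{p^n}.$$ *)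

(* Defs.v *)
From HB Require Import structures.
From mathcomp Require Import all_boot all_order all_algebra all_fingroup all_solvable all_field.
From mathcomp Require Import all_classical all_reals all_analysis.

Set Implicit Arguments.
Unset Strict Implicit.
Unset Printing Implicit Defensive.

Import Order.TTheory GRing.Theory Num.Theory.
Import numFieldNormedType.Exports.

Local Open Scope ring_scope.

(* The trace as an element of 'F_p rather than of the prime subfield of F:
   [absTrE] shows that the sought scalar always exists, and it is unique. *)
Definition absTr (p : nat) (F : finFieldType) (charF : p \in [pchar F]) (x : F)
    : 'F_p :=
  odflt 0 [pick c : 'F_p |
    (c%:A : pPrimeCharType charF)
      == galTrace 1%AS {:pPrimeCharType charF}%AS x].

Lemma absTrE (p : nat) (F : finFieldType) (charF : p \in [pchar F]) (x : F) :
  ((absTr charF x)%:A : pPrimeCharType charF)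
    = galTrace 1%AS {:pPrimeCharType charF}%AS x.
Proof.
rewrite /absTr; case: pickP => [c /eqP //|no].
have /vlineP[c Dc] : galTrace 1%AS {:pPrimeCharType charF}%AS x \in 1%VS.
  by apply: mem_galTrace (memvf _); apply: finField_galois; apply: sub1v.
by move: (no c); rewrite Dc eqxx.
Qed.

Lemma absTr_sumX (p n : nat) (F : finFieldType) (charF : p \in [pchar F])
    (x : F) :
  #|F| = (p ^ n)%N ->
  ((absTr charF x : nat)%:R : F) = \sum_(i < n) x ^+ (p ^ i).
Proof.
move=> cardF; have p_pr := pcharf_prime charF.
set L := pPrimeCharType charF.
have -> : ((absTr charF x : nat)%:R : F) = ((absTr charF x)%:A : L).
  exact: esym (mulr1 _).
rewrite absTrE.
have [a gen_a Da] := @finField_galois_generator _ L 1%AS {:L}%AS (sub1v _).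
have dimL : \dim {:L} = n.
  by rewrite pprimeChar_dimf cardF pfactorK.
have orda : #[a]%g = n.
  rewrite orderE -(eqP gen_a) -galois_dim ?dimv1 ?divn1 //.
  by apply: finField_galois; apply: sub1v.
have Xa i : (a ^+ i)%g (x : L) = (x : L) ^+ (p ^ i).
  elim: i => [|i IHi]; first by rewrite gal_id expr1.
  rewrite expgSr galM ?memvf // IHi Da ?memvf //.
  by rewrite dimv1 card_Fp // expn1 expnSr exprM.
rewrite /galTrace (eqP gen_a).
have -> : \sum_(y in <[a]>%g) y (x : L) = \sum_(i < #[a]%g) (a ^+ i)%g (x : L).
  have inj : {in [pred i : 'I_#[a]%g | true] &,
      injective (fun i : 'I_#[a]%g => (a ^+ i)%g)}.
    by move=> i j _ _ /eqP; rewrite eq_expg_ord // => /eqP.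
  rewrite -(big_imset (fun y : gal_of {:L} => y (x : L)) inj) /=.
  apply: eq_bigl => y; apply/idP/imsetP => [/cyclePmin[i lti ->]|[i _ ->]].
    by exists (Ordinal lti).
  exact: mem_cycle.
by rewrite orda; apply: eq_bigr => i _; exact: Xa.
Qed.

(* A random variable on a finite sample space [Omega] with point masses [P] is
   a function out of [Omega]. *)
Section Entropy.
Variable R : realType.

Definition log2 (x : R) : R := ln x / ln 2.

Definition law (Omega A : finType) (P : Omega -> R) (X : Omega -> A) (a : A)
    : R :=
  \sum_(w | X w == a) P w.

(* [ln 0 = 0], in accordance with the convention 0 log 0 = 0. *)
Definition shannon (A : finType) (q : A -> R) : R :=
  - \sum_a q a * log2 (q a).

Definition entropy (Omega A : finType) (P : Omega -> R) (X : Omega -> A) : R :=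
  shannon (law P X).

(* Values [b] of probability 0 contribute 0. *)
Definition cond_entropy (Omega A B : finType) (P : Omega -> R)
    (X : Omega -> A) (Y : Omega -> B) : R :=
  \sum_b law P Y b *
    shannon (fun a => law P (fun w => (X w, Y w)) (a, b) / law P Y b).

Definition unif (A : finType) (_ : A) : R := #|A|%:R^-1.

(* Joint law of independent variables with point masses [P] and [Q]. *)
Definition indep_law (A B : finType) (P : A -> R) (Q : B -> R) (w : A * B) : R :=
  P w.1 * Q w.2.

End Entropy.

Section Code.
Variables (R : realType) (p r : nat).
Variables (F : finFieldType) (charF : p \in [pchar F]).

Definition encode (k s : F) : F * 'F_p := (s + k ^+ (p ^ r), absTr charF (s * k)).

Definition accepts (k : F) (m : F * 'F_p) : bool :=
  absTr charF ((m.1 - k ^+ (p ^ r)) * k) == m.2.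

(* Outcomes are pairs (source state, key). *)
Definition code_law : F * F -> R := indep_law (@unif R F) (@unif R F).

Definition rule_rv (w : F * F) : {ffun F -> F * 'F_p} := [ffun s => encode w.2 s].

Definition message_rv (w : F * F) : F * 'F_p := encode w.2 w.1.

Definition impersonation : R :=
  \big[Num.max/0]_(ab : F * 'F_p)
    (#|[set x : F | absTr charF (ab.1 * x - x ^+ (p ^ r).+1) == ab.2]|%:R
       / #|F|%:R).

Lemma impersonationE :
  impersonation =
  \big[Num.max/0]_(m : F * 'F_p) \sum_(k | accepts k m) @unif R F k.
Proof.
apply: eq_bigr => -[a b] _; rewrite /unif sumr_const -[RHS]mulr_natl.
congr (_%:R * _); rewrite cardsE; apply: eq_card => x.
by rewrite unfold_in [RHS]unfold_in /accepts mulrBl -exprSr.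
Qed.

End Code.

(* Main.v *)
Require Import Defs.
From HB Require Import structures.
From mathcomp Require Import all_boot all_order all_algebra all_fingroup all_field.
From mathcomp Require Import all_classical all_reals all_analysis.
From mathcomp Require Import ring lra zify.
Import Order.TTheory GRing.Theory Num.Theory.
Import numFieldNormedType.Exports.
Local Open Scope classical_set_scope.
Local Open Scope ring_scope.

(* Put q = p^n, P = p^r, f(x) = Tr(a x - x^(P+1)) and N_b = #{x | f(x) = b}.
   Then sum_b N_b^2 = sum_h #{x | f(x+h) = f(x)}.  For fixed h, the difference
   f(x+h) - f(x) is affine in x with linear part -Tr((h + h^(P^2)) x^P), so the
   h-th term is q/p unless h + h^(P^2) = 0, which has at most P^2 solutions.
   Since sum_b N_b = q, this second moment gives |p N_b - q| <= p P sqrt q for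
   all a and b: every fibre has frequency (1 + o(1))/p, uniformly.

   Given a message m, the key is uniform on the fibre attached to m, of size
   N(m) say, so H(E|M) - H(E) is an average of log2 (N(m)/q), whereas P_I is the
   maximum of N(m)/q.  Both 2^(H(E|M) - H(E)) and P_I are thus (1 + o(1))/p. *)

(** * The trace, and counting fibres and roots *)

Lemma Fp_in_alg_inj {p : nat} {F : finFieldType} (charF : p \in [pchar F]) :
  injective (fun c : 'F_p => c%:A : pPrimeCharType charF).
Proof.
move=> c d /eqP; rewrite -subr_eq0 -scalerBl scaler_eq0 oner_eq0 orbF subr_eq0.
by move/eqP.
Qed.

Lemma absTr_is_zmod_morphism (p : nat) (F : finFieldType)
  (charF : p \in [pchar F]) : zmod_morphism (absTr charF).
Proof.
by move=> x y; apply: (Fp_in_alg_inj charF); rewrite scalerBl !absTrE raddfB.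
Qed.

HB.instance Definition _ (p : nat) (F : finFieldType)
    (charF : p \in [pchar F]) :=
  GRing.isZmodMorphism.Build F 'F_p (absTr charF)
    (absTr_is_zmod_morphism _ _ charF).

(** In the power sum for the trace, raising [x] to the [p] shifts the summands cyclically, because
    [x ^+ (p ^ n) = x]; then induct on [r]. *)
Lemma absTr_Frobenius (p n r : nat) (F : finFieldType)
    (charF : p \in [pchar F]) (x : F) :
  #|F| = (p ^ n)%N -> absTr charF (x ^+ (p ^ r)) = absTr charF x.
Proof.
move=> cardF; elim: r x => [|r IHr] x; first by rewrite expn0 expr1.
rewrite expnS exprM IHr; apply: (Fp_in_alg_inj charF).
have E (c : 'F_p) : (c%:A : pPrimeCharType charF) = (c : nat)%:R :> F.
  exact: mulr1.
rewrite !E !(@absTr_sumX p n) //.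
case: n cardF => [|n] cardF; first by rewrite !big_ord0.
rewrite big_ord_recr big_ord_recl /= -!exprM -expnS -cardF expf_card addrC.
by congr (_ + _); apply: eq_bigr => i _; rewrite -exprM -expnS.
Qed.

Lemma card_roots_le (F : finFieldType) (P : {poly F}) :
  P != 0 -> (#|[set x | root P x]%SET| < size P)%N.
Proof.
move=> P0; rewrite cardE; apply: max_poly_roots (enum_uniq _) => //.
by apply/allP => x; rewrite mem_enum inE.
Qed.

(** As a polynomial the trace has degree less than [#|F|], so it cannot vanish on all of [F]. *)
Lemma absTr_neq0 (p n : nat) (F : finFieldType) (charF : p \in [pchar F]) :
  (0 < n)%N -> #|F| = (p ^ n)%N -> exists x, absTr charF x != 0.
Proof.
case: n => // n _ cardF; have p_gt1 := prime_gt1 (pcharf_prime charF).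
apply/existsP; apply: contraT; rewrite negb_exists => /forallP Tr0.
pose P : {poly F} := \sum_(i < n.+1) 'X^(p ^ i).
have P_neq0 : P != 0.
  (* Only the summand [i = 0] contributes to the coefficient of degree 1, which is therefore 1. *)
  apply/negP => /eqP/(congr1 (fun q : {poly F} => q`_1)); rewrite coef0.
  rewrite coef_sum big_ord_recl coefXn expn0 eqxx big1 ?addr0.
    by move/eqP; rewrite oner_eq0.
  move=> i _; rewrite coefXn /= [1%N == _]eqn_leq.
  by rewrite [(_ <= 1)%N]leqNgt -{2}(expn0 p) ltn_exp2l // andbF.
have rootP : [set x | root P x]%SET = [set: F]%SET.
  apply/setP => x; rewrite !inE /root horner_sum.
  under eq_bigr do rewrite hornerXn.
  rewrite -(absTr_sumX charF x cardF).
  by have /negbNE/eqP -> := Tr0 x; rewrite eqxx.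
have := card_roots_le _ _ P_neq0; rewrite rootP cardsT cardF ltnNge => /negP[].
apply: leq_trans (size_sum _ _ _) _; apply/bigmax_leqP => i _.
by rewrite size_polyXn ltn_exp2l.
Qed.

(** Multiples of [x0] already reach every value in ['F_p], so all [p] fibres are translates of the
    kernel. *)
Lemma card_fiber_additive (p : nat) (G : finZmodType) (f : {additive G -> 'F_p})
    (x0 : G) (c : 'F_p) :
  prime p -> f x0 != 0 -> (p * #|[set x | f x == c]%SET|)%N = #|G|.
Proof.
move=> p_pr fx0.
have fibE d : #|[set x | f x == d]%SET| = #|[set x | f x == 0]%SET|.
  have [y fy] : exists y, f y = d.
    exists (x0 *+ (d / f x0)); rewrite raddfMn -mulr_natr natr_Zp mulrC.
    by rewrite divfK.
  rewrite -[RHS](card_imset _ (addIr y)); apply: eq_card => x; rewrite inE.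
  apply/eqP/imsetP => [fx|[z]]; last first.
    by rewrite inE => /eqP fz ->; rewrite raddfD fz add0r.
  by exists (x - y); rewrite ?subrK // inE raddfB fx fy subrr.
rewrite -[RHS]sum1_card (partition_big f xpredT) //=.
under eq_bigr => d _ do rewrite sum1_card -cardsE fibE.
by rewrite fibE sum_nat_const card_Fp.
Qed.

(** Both sides count the pairs [(x, y)] with [f x = f y], on the right through [y = x + h]. *)
Lemma sum_sqr_card_fiber (G : finZmodType) (A : finType) (f : G -> A) :
  (\sum_c #|[set x | f x == c]%SET| ^ 2 =
   \sum_h #|[set x | f (x + h)%R == f x]%SET|)%N.
Proof.
transitivity (\sum_x #|[set y | f y == f x]%SET|)%N.
  rewrite [RHS](partition_big f xpredT) //=; apply: eq_bigr => c _.
  under [RHS]eq_bigr => x /eqP -> do [].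
  by rewrite sum_nat_const -cardsE mulnn.
under eq_bigr do rewrite -sum1dep_card big_mkcond.
under [RHS]eq_bigr do rewrite -sum1dep_card big_mkcond.
rewrite [RHS]exchange_big; apply: eq_bigr => x _ /=.
by rewrite (reindex_inj (addrI x)).
Qed.

Lemma exprD_pcharX (p r : nat) (F : finFieldType) (charF : p \in [pchar F])
    (x y : F) :
  (x + y) ^+ (p ^ r) = x ^+ (p ^ r) + y ^+ (p ^ r).
Proof.
apply: exprDn_pchar.
by rewrite pnatX pnatE ?(pcharf_prime charF) ?charF.
Qed.

Lemma expr_pcharX_inj (p r : nat) (F : finFieldType) (charF : p \in [pchar F]) :
  injective (fun x : F => x ^+ (p ^ r)).
Proof.
move=> x y /= xy; apply/eqP; rewrite -subr_eq0.
have := exprD_pcharX p r F charF (x - y) y.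
rewrite /= subrK xy -[LHS]add0r => /addIr/esym/eqP.
by rewrite expf_eq0 => /andP[].
Qed.

Lemma card_radical_le (m : nat) (F : finFieldType) :
  (1 < m)%N -> (#|[set h : F | (h + h ^+ m == 0)%R]%SET| <= m)%N.
Proof.
move=> m_gt1; set P : {poly F} := 'X^m + 'X.
have sizeP : size P = m.+1 by rewrite size_polyDl ?size_polyXn ?size_polyX.
have P_neq0 : P != 0 by rewrite -size_poly_gt0 sizeP.
have := card_roots_le _ _ P_neq0; rewrite sizeP ltnS; congr (_ <= _)%N.
by apply: eq_card => h; rewrite !inE /root hornerD hornerXn hornerX addrC.
Qed.

(** * Second moment of the fibre sizes of the trace form *)

Section Uniformity.
Variables (p n r : nat) (F : finFieldType) (charF : p \in [pchar F]).
Hypotheses (n_gt0 : (0 < n)%N) (r_gt0 : (0 < r)%N) (cardF : #|F| = (p ^ n)%N).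
Local Notation P := (p ^ r)%N.
Local Notation Tr := (absTr charF).

Definition fiber (a : F) (b : 'F_p) : {set F} :=
  [set x | Tr (a * x - x ^+ P.+1) == b]%SET.

(** The polarization of the quadratic form [Tr (x ^+ P.+1)]. *)
Definition polar (h x : F) : 'F_p := Tr (x ^+ P * h + h ^+ P * x).

Lemma polar_is_zmod_morphism (h : F) : zmod_morphism (polar h).
Proof.
move=> x y; rewrite /polar -raddfB; congr Tr.
have -> : (x - y) ^+ P = x ^+ P - y ^+ P.
  by rewrite -[in RHS](subrK y x) [in RHS]exprD_pcharX // addrK.
ring.
Qed.

HB.instance Definition _ (h : F) :=
  GRing.isZmodMorphism.Build F 'F_p (polar h) (polar_is_zmod_morphism h).

(** The trace of [h ^+ P * x] is unchanged by a further [P]-th power, after which both summands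
    contain [x ^+ P] as a factor. *)
Lemma polarE (h x : F) : polar h x = Tr ((h + h ^+ (p ^ (2 * r))) * x ^+ P).
Proof.
rewrite /polar raddfD /= -(absTr_Frobenius p n r F charF (h ^+ P * x)) //.
rewrite -raddfD /=; congr Tr; rewrite exprMn -exprM -expnD addnn -mul2n; ring.
Qed.

Lemma polar_neq0 (h : F) :
  h + h ^+ (p ^ (2 * r)) != 0 -> exists x, polar h x != 0.
Proof.
move=> h_neq0; have [z Tz] := absTr_neq0 p n F charF n_gt0 cardF.
have inj := expr_pcharX_inj p r F charF.
(* Since [x ^+ P] takes every value, [x] can be chosen so that the argument of the trace in [polarE]
   becomes [z]. *)
exists (invF inj (z / (h + h ^+ (p ^ (2 * r))))).
by rewrite polarE (f_invF inj) mulrC divfK.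
Qed.

(** Hence, for fixed [h], the [x] at which the form is invariant under the shift by [h] make up one
    fibre of the additive map [polar h]. *)
Lemma trace_form_shift (a h x : F) :
  Tr (a * (x + h) - (x + h) ^+ P.+1) - Tr (a * x - x ^+ P.+1) =
  Tr (a * h - h ^+ P.+1) - polar h x.
Proof.
rewrite /polar -!raddfB; congr Tr.
by rewrite !exprS exprD_pcharX //; ring.
Qed.

Lemma sum_sqr_fiber_le (a : F) :
  (p * \sum_b #|fiber a b| ^ 2 <= #|F| ^ 2 + p * p ^ (2 * r) * #|F|)%N.
Proof.
have p_pr := pcharf_prime charF.
have -> := sum_sqr_card_fiber F 'F_p (fun x => Tr (a * x - x ^+ P.+1)).
rewrite big_distrr /= -mulnn.
(* After multiplication by [p], an [h] outside the radical contributes exactly [#|F|]; inside it the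
   trivial bound [p * #|F|] suffices. *)
apply: (@leq_trans (\sum_h (#|F| +
    if (h + h ^+ (p ^ (2 * r)) == 0)%R then p * #|F| else 0))%N).
  apply: leq_sum => h _; case: ifPn => [_|h_neq0]; last first.
    have [x0 hx0] := polar_neq0 _ h_neq0.
    have cardE := card_fiber_additive p F (polar h) x0 (Tr (a * h - h ^+ P.+1)).
    rewrite addn0 -cardE //.
    rewrite leq_mul2l; apply/orP; right.
    apply/subset_leq_card/fintype.subsetP => x.
    rewrite !inE -subr_eq0 trace_form_shift subr_eq0 => /eqP ->; exact: eqxx.
  by apply: leq_trans (leq_addl _ _); rewrite leq_mul2l max_card orbT.
rewrite big_split /= sum_nat_const leq_add2l -big_mkcond /= sum_nat_const.
rewrite -cardsE mulnCA mulnAC -!mulnA leq_mul2l; apply/orP; right.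
rewrite mulnC leq_mul2l card_radical_le ?orbT //.
(* Here [r_gt0] gives [1 < p ^ (2 * r)], as [card_radical_le] requires. *)
by rewrite -{1}(expn0 p) ltn_exp2l ?muln_gt0 ?prime_gt1.
Qed.

Lemma sum_card_fiber (a : F) :
  (\sum_b #|fiber a b|)%N = #|F|.
Proof.
rewrite -[RHS]sum1_card.
rewrite (partition_big (fun x => Tr (a * x - x ^+ P.+1)) xpredT) //=.
by apply: eq_bigr => b _; rewrite sum1_card -cardsE.
Qed.

Lemma fiber_deviation (R : realDomainType) (a : F) (b : 'F_p) :
  (p%:R * #|fiber a b|%:R - #|F|%:R) ^+ 2 <= (p ^ (2 * r).+2 * #|F|)%N%:R :> R.
Proof.
have p_pr := pcharf_prime charF.
apply: (@le_trans _ _ (\sum_c (p%:R * #|fiber a c|%:R - #|F|%:R) ^+ 2)).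
  by rewrite (bigD1 b) //= lerDl sumr_ge0 // => c _; exact: sqr_ge0.
(* Variance identity: expand the square and use that the fibre sizes add up to [#|F|]. The main
   terms of [sum_sqr_fiber_le] then cancel. *)
have -> : \sum_c (p%:R * #|fiber a c|%:R - #|F|%:R) ^+ 2 =
    p%:R * (p * \sum_c #|fiber a c| ^ 2)%N%:R - p%:R * #|F|%:R ^+ 2 :> R.
  have sum1 : \sum_c #|fiber a c|%:R = #|F|%:R :> R.
    by rewrite -natr_sum sum_card_fiber.
  transitivity (\sum_c (p%:R ^+ 2 * (#|fiber a c| ^ 2)%N%:R
      - 2 * p%:R * #|F|%:R * #|fiber a c|%:R + #|F|%:R ^+ 2) : R).
    by apply: eq_bigr => c _; rewrite natrX; ring.
  rewrite big_split sumrB /= sumr_const card_Fp // -!mulr_sumr sum1 -natr_sum.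
  by rewrite natrM -[_ *+ p]mulr_natl; ring.
rewrite lerBlDr; have := sum_sqr_fiber_le a; rewrite -(ler_nat R).
move=> /(ler_wpM2l (ler0n R p))/le_trans; apply.
by rewrite -natrX -!natrM -natrD ler_nat !expnS; nia.
Qed.
End Uniformity.

(** * Laws of random variables and binary logarithms *)

Lemma big_inj_image {R : zmodType} (A B : finType) (g : A -> B) (f : B -> R) :
  injective g -> (forall b, b \notin codom g -> f b = 0) ->
  \sum_b f b = \sum_a f (g a).
Proof.
move=> g_inj f0; rewrite (bigID (mem (codom g))) /= [X in _ + X]big1 // addr0.
rewrite -big_uniq /=; last by rewrite map_inj_uniq ?enum_uniq.
rewrite big_image.
by apply: eq_bigl => a; rewrite inE.
Qed.

Lemma law_marginal (R : realType) (Omega A B : finType) (P : Omega -> R)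
    (X : Omega -> A) (Y : Omega -> B) (b : B) :
  law P Y b = \sum_a law P (fun w => (X w, Y w)) (a, b).
Proof.
rewrite /law (partition_big X xpredT) //=; apply: eq_bigr => a _.
by apply: eq_bigl => w; rewrite xpair_eqE andbC.
Qed.

Lemma log2M (R : realType) (x y : R) : 0 < x -> 0 < y ->
  log2 (x * y) = log2 x + log2 y.
Proof. by move=> x0 y0; rewrite /log2 lnM ?posrE // mulrDl. Qed.

Lemma log2V (R : realType) (x : R) : 0 < x -> log2 x^-1 = - log2 x.
Proof. by move=> x0; rewrite /log2 lnV ?posrE // mulNr. Qed.

Lemma ler_log2 (R : realType) (x y : R) : 0 < x -> x <= y -> log2 x <= log2 y.
Proof.
move=> x0 xy; rewrite ler_pM2r ?ler_ln ?posrE ?(lt_le_trans x0 xy) //.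
by rewrite invr_gt0 ln_gt0 // ltr1n.
Qed.

Lemma powR_log2 (R : realType) (x : R) : 0 < x -> 2 `^ log2 x = x.
Proof.
move=> x0; have ln2 : ln 2 != 0 :> R by rewrite gt_eqF // ln_gt0 // ltr1n.
by rewrite /powR pnatr_eq0 /= divfK // lnK ?posrE.
Qed.

(** * Entropies and impersonation probability in terms of fibre sizes *)

Section CodeEntropy.
Variables (R : realType) (p r : nat).
Variables (F : finFieldType) (charF : p \in [pchar F]).
Local Notation q := (#|F|%:R : R).
Local Notation P := (p ^ r)%N.
Local Notation law_code := (@code_law R F).
Local Notation rule := (rule_rv r charF).
Local Notation message := (message_rv r charF).
Local Notation N m := #|fiber p r F charF m.1 m.2|.

Definition rule_of (k : F) : {ffun F -> F * 'F_p} :=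
  [ffun s => encode r charF k s].

(** Encoding the source state 0 reveals [k ^+ P], hence [k]; the random rule thus carries the same
    information as the key. *)
Lemma rule_of_inj : injective rule_of.
Proof.
move=> k l /ffunP/(_ 0); rewrite !ffunE => -[+ _]; rewrite !add0r.
exact: expr_pcharX_inj.
Qed.

Lemma card_gt0R : 0 < q.
Proof. by rewrite ltr0n; apply/card_gt0P; exists 0. Qed.

(** The first component of a message determines the source state from the key; what remains of the
    second is a condition on the key alone. Each key in the fibre thus comes from exactly one source
    state. *)
Lemma encode_eq (k s : F) (m : F * 'F_p) :
  (encode r charF k s == m) =
  (s == m.1 - k ^+ P) && (k \in fiber p r F charF m.1 m.2).
Proof.
case: m => a b; rewrite /encode xpair_eqE inE /= exprSr -mulrBl.
by rewrite eq_sym -subr_eq eq_sym; case: eqP => //= ->.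
Qed.

Lemma law_rule_message (k : F) (m : F * 'F_p) :
  law law_code (fun w => (rule w, message w)) (rule_of k, m) =
  (k \in fiber p r F charF m.1 m.2)%:R / q ^+ 2.
Proof.
rewrite /law.
under eq_bigl => w do
  rewrite xpair_eqE (inj_eq rule_of_inj) /message_rv encode_eq.
rewrite (eq_bigl (fun w : F * F =>
    (w == (m.1 - k ^+ P, k)) && (k \in fiber p r F charF m.1 m.2))); last first.
  case=> s l; rewrite xpair_eqE /=.
  by have [->|] := eqVneq l k; rewrite ?andbF ?andbT.
rewrite big_mkcondr big_pred1_eq /code_law /indep_law /unif -expr2 exprVn.
by case: ifP; rewrite ?mul1r ?mul0r.
Qed.

Lemma law_rule_message0 (f : {ffun F -> F * 'F_p}) (m : F * 'F_p) :
  f \notin codom rule_of ->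
  law law_code (fun w => (rule w, message w)) (f, m) = 0.
Proof.
move=> Nf; rewrite /law big_pred0 // => -[s k]; rewrite xpair_eqE andbC.
apply/negbTE; rewrite negb_and; apply/orP; right; apply: contra Nf => /eqP <-.
exact: codom_f.
Qed.

Lemma law_message (m : F * 'F_p) : law law_code message m = (N m)%:R / q ^+ 2.
Proof.
rewrite (law_marginal _ _ _ _ _ rule).
(* The sum runs over all functions from [F] to messages; those that are not encoding rules have mass
   0, so it becomes a sum over keys. *)
rewrite (big_inj_image _ _ _ _ rule_of_inj); last first.
  by move=> f; apply: law_rule_message0.
under eq_bigr do rewrite law_rule_message.
by rewrite -mulr_suml -natr_sum -sum1_card [in RHS]big_mkcond.
Qed.

Lemma law_rule (k : F) : law law_code rule (rule_of k) = q^-1.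
Proof.
rewrite /law; under eq_bigl => w do rewrite (inj_eq rule_of_inj).
rewrite -(pair_big xpredT (pred1 k) (fun s l => law_code (s, l))) /=.
under eq_bigr do rewrite big_pred1_eq.
rewrite /code_law /indep_law /unif /= sumr_const -[_ *+ _]mulr_natl mulrA.
by rewrite divff ?mul1r // gt_eqF // card_gt0R.
Qed.

Lemma law_rule0 (f : {ffun F -> F * 'F_p}) :
  f \notin codom rule_of -> law law_code rule f = 0.
Proof.
move=> Nf; rewrite /law big_pred0 // => -[s k].
by apply: contraNF Nf => /eqP <-; exact: codom_f.
Qed.

Lemma entropy_rule : entropy law_code rule = log2 q.
Proof.
rewrite /entropy /shannon (big_inj_image _ _ _ _ rule_of_inj); last first.
  by move=> f Nf; rewrite law_rule0 ?mul0r.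
under eq_bigr do rewrite law_rule.
rewrite sumr_const -[_ *+ _]mulr_natl mulrA divff ?gt_eqF ?card_gt0R // mul1r.
by rewrite log2V ?opprK // card_gt0R.
Qed.

(** Given [m], the key is uniform on a fibre of size [N m], so its conditional entropy is
    [log2 (N m)%:R]. *)
Lemma cond_entropy_rule : (forall m, 0 < N m)%N ->
  cond_entropy law_code rule message =
  \sum_m (N m)%:R / q ^+ 2 * log2 (N m)%:R.
Proof.
move=> N_gt0; apply: eq_bigr => m _; rewrite law_message; congr (_ * _).
have q2 : q ^+ 2 != 0 by rewrite expf_neq0 // gt_eqF // card_gt0R.
have N0 : 0 < (N m)%:R :> R by rewrite ltr0n.
rewrite /shannon (big_inj_image _ _ _ _ rule_of_inj); last first.
  by move=> f Nf; rewrite law_rule_message0 ?mul0r.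
rewrite (eq_bigr (fun k => if k \in fiber p r F charF m.1 m.2
    then - ((N m)%:R^-1 * log2 (N m)%:R) else 0 : R)).
  rewrite -big_mkcond sumr_const /= mulNrn opprK -[_ *+ _]mulr_natl mulrA.
  rewrite divff ?mul1r //.
  by rewrite gt_eqF.
move=> k _; rewrite law_rule_message; case: ifP => _; last by rewrite !mul0r.
have -> : 1 / q ^+ 2 / ((N m)%:R / q ^+ 2) = (N m)%:R^-1 :> R.
  by field; rewrite !gt_eqF ?card_gt0R.
by rewrite log2V // mulrN.
Qed.

Lemma sum_law_message : \sum_m (N m)%:R / q ^+ 2 = 1 :> R.
Proof.
rewrite -mulr_suml -natr_sum.
rewrite -(pair_bigA _ (fun a b => #|fiber p r F charF a b|)) /=.
under eq_bigr do rewrite sum_card_fiber.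
rewrite sum_nat_const mulnn natrX divff //.
by rewrite expf_neq0 // gt_eqF // card_gt0R.
Qed.

Lemma powR_entropy_bounds (lo hi : R) : 0 < lo ->
  (forall m, lo <= (N m)%:R / q <= hi) ->
  lo <= 2 `^ (cond_entropy law_code rule message - entropy law_code rule) <= hi.
Proof.
move=> lo_gt0 Nb.
have q_gt0 := card_gt0R.
have N_gt0 m : (0 < N m)%N.
  rewrite lt0n; apply/eqP => N0; have /andP[+ _] := Nb m.
  by rewrite N0 mul0r leNgt lo_gt0.
have hi_gt0 : 0 < hi.
  by apply: lt_le_trans lo_gt0 _; have /andP[/le_trans + ?] := Nb (0, 0); apply.
have w0 m : 0 <= (N m)%:R / q ^+ 2 by rewrite divr_ge0 // exprn_ge0 // ltW.
(* The weights sum to 1, so a constant is its own average; this allows termwise comparison with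
   [log2 lo] and [log2 hi]. *)
have wM c : c = \sum_m (N m)%:R / q ^+ 2 * c.
  by rewrite -mulr_suml sum_law_message mul1r.
have -> : cond_entropy law_code rule message - entropy law_code rule =
    \sum_m (N m)%:R / q ^+ 2 * log2 ((N m)%:R / q).
  rewrite cond_entropy_rule // entropy_rule (wM (log2 q)) -sumrB.
  by apply: eq_bigr => m _; rewrite -mulrBr log2M ?log2V ?invr_gt0 // ltr0n.
apply/andP; split.
  rewrite -[leLHS]powR_log2 // ler_powR ?ler1n // (wM (log2 lo)).
  apply: ler_sum => m _; apply: ler_wpM2l => //; apply: ler_log2 => //.
  by have /andP[] := Nb m.
rewrite -[leRHS]powR_log2 // ler_powR ?ler1n // (wM (log2 hi)).
apply: ler_sum => m _; apply: ler_wpM2l => //; apply: ler_log2.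
  by rewrite divr_gt0 // ltr0n.
by have /andP[] := Nb m.
Qed.

Lemma impersonation_bounds (lo hi : R) : 0 <= hi ->
  (forall m, lo <= (N m)%:R / q <= hi) ->
  lo <= impersonation R r charF <= hi.
Proof.
move=> hi0 Nb; apply/andP; split.
  have /andP[/le_trans + _] := Nb (0, 0); apply.
  exact: (le_bigmax 0 (fun m : F * 'F_p => (N m)%:R / q)).
(* The maximum starts from the default value 0, hence the hypothesis [0 <= hi]. *)
by apply: bigmax_le => // m _; have /andP[] := Nb m.
Qed.
End CodeEntropy.

(** * Relative error of the fibre frequencies and passage to the limit *)

Definition relative_error (R : realType) (p r n : nat) : R :=
  p%:R ^+ r.+1 * (Num.sqrt p%:R)^-1 ^+ n.

(** A geometric sequence of ratio [1 / sqrt p], up to a constant factor. *)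
Lemma cvg_relative_error (R : realType) (p r : nat) :
  (1 < p)%N -> relative_error R p r @ \oo --> (0 : R).
Proof.
move=> p1; rewrite -(mulr0 (p%:R ^+ r.+1)); apply: cvgMr.
apply: cvg_expr.
have sqrt_gt1 : 1 < Num.sqrt p%:R :> R.
  by rewrite -[ltLHS]sqrtr1 ltr_sqrt ?ltr1n // ltr0n ltnW.
by rewrite ger0_norm ?invr_ge0 ?sqrtr_ge0 // invf_lt1 // (lt_trans ltr01).
Qed.

Lemma fiber_frequency_bounds (R : realType) (p n r : nat) (F : finFieldType)
    (charF : p \in [pchar F]) (m : F * 'F_p) (d := relative_error R p r n) :
  (0 < n)%N -> (0 < r)%N -> #|F| = (p ^ n)%N ->
  (1 - d) / p%:R <= #|fiber p r F charF m.1 m.2|%:R / #|F|%:R <= (1 + d) / p%:R.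
Proof.
move=> n0 r0 cardF; have p_pr := pcharf_prime charF.
have p_gt0 : 0 < p%:R :> R by rewrite ltr0n prime_gt0.
have q_gt0 : 0 < #|F|%:R :> R by exact: card_gt0R.
have d_ge0 : 0 <= d by rewrite mulr_ge0 ?exprn_ge0 ?invr_ge0 ?sqrtr_ge0.
(* With [#|F| = p ^ n], [d] is [p ^ r.+1 / sqrt #|F|], chosen so that the bound of [fiber_deviation]
   is exactly the square of [d * #|F|]. *)
have d2 : (d * #|F|%:R) ^+ 2 = (p ^ (2 * r).+2 * #|F|)%N%:R.
  have -> : (2 * r).+2 = (r.+1 * 2)%N by rewrite mul2n muln2.
  rewrite /d /relative_error cardF natrM !natrX exprM !exprMn.
  rewrite [_ ^+ n ^+ 2]exprAC exprVn sqr_sqrtr ?ler0n // -mulrA; congr (_ * _).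
  by rewrite exprVn [p%:R ^+ n ^+ 2]expr2 mulKf // expf_neq0 // gt_eqF.
have := fiber_deviation p n r F charF n0 r0 cardF R m.1 m.2.
rewrite -d2 -ler_sqrt ?sqr_ge0 // !sqrtr_sqr [leRHS]ger0_norm ?mulr_ge0 //.
rewrite ler_norml => /andP[lo hi].
apply/andP; split.
  by rewrite ler_pdivrMr // mulrAC ler_pdivlMr //; nra.
by rewrite ler_pdivrMr // mulrAC ler_pdivlMr //; nra.
Qed.

Theorem theorem4 (R : realType) (p r : nat) (p_prime : prime p) (p_odd : odd p)
    (r_ge1 : (1 <= r)%N) (F : nat -> finFieldType)
    (charF : forall n, p \in [pchar (F n)])
    (cardF : forall n, (4 <= n)%N -> #|F n| = (p ^ n)%N) :
  (fun n : nat =>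
     2 `^ (cond_entropy (@code_law R (F n)) (rule_rv r (charF n))
                        (message_rv r (charF n))
           - entropy (@code_law R (F n)) (rule_rv r (charF n)))
       / impersonation R r (charF n)) @ \oo --> (1 : R).
Proof.
pose d := relative_error R p r.
have d0 : d @ \oo --> (0 : R) by apply: cvg_relative_error; exact: prime_gt1.
have d1 : (fun n => 1 + d n) @ \oo --> (1 : R).
  by rewrite -[X in _ --> X]addr0; apply: cvgD d0; exact: cvg_cst.
have d1' : (fun n => 1 - d n) @ \oo --> (1 : R).
  by rewrite -[X in _ --> X]subr0; apply: cvgB d0; exact: cvg_cst.
(* Numerator and denominator both lie between [(1 - d n) / p] and [(1 + d n) / p]; the factor
   [1 / p] cancels in the quotient. *)
apply: (@squeeze_cvgr _ _ _ _ (fun n => (1 - d n) / (1 + d n))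
  (fun n => (1 + d n) / (1 - d n))).
- near=> n.
  have n4 : (4 <= n)%N by near: n; exact: nbhs_infty_ge.
  (* This makes the lower bound positive, so that logarithms and quotients can be compared. *)
  have d_lt1 : d n < 1 by near: n; exact: (cvgr_lt _ d0).
  have p_gt0 : 0 < p%:R :> R by rewrite ltr0n prime_gt0.
  have d_ge0 : 0 <= d n by rewrite mulr_ge0 ?exprn_ge0 ?invr_ge0 ?sqrtr_ge0.
  have lo_gt0 : 0 < (1 - d n) / p%:R by rewrite divr_gt0 ?subr_gt0.
  have hi_gt0 : 0 < (1 + d n) / p%:R by rewrite divr_gt0 // ltr_wpDr.
  have n_gt0 : (0 < n)%N by apply: leq_trans n4.
  have Nb m := fiber_frequency_bounds R p n r (F n) (charF n) m
    n_gt0 r_ge1 (cardF n n4).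
  have /andP[E1 E2] :=
    powR_entropy_bounds R p r (F n) (charF n) _ _ lo_gt0 Nb.
  have /andP[I1 I2] :=
    impersonation_bounds R p r (F n) (charF n) _ _ (ltW hi_gt0) Nb.
  have E (a b : R) : a / b = (a / p%:R) / (b / p%:R).
    by rewrite invf_div mulrA divfK // gt_eqF.
  have I0 := lt_le_trans lo_gt0 I1.
  have E0 := le_trans (ltW lo_gt0) E1.
  rewrite (E (1 - d n) (1 + d n)) (E (1 + d n) (1 - d n)).
  apply/andP; split; apply: ler_pM => //;
    by rewrite ?invr_ge0 ?lef_pV2 ?posrE ?(ltW lo_gt0) ?(ltW hi_gt0) ?(ltW I0).
- rewrite -[X in _ --> X]divr1; apply: cvgM => //.
  by apply: cvgV; rewrite ?oner_neq0.
- rewrite -[X in _ --> X]divr1; apply: cvgM => //.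
  by apply: cvgV; rewrite ?oner_neq0.
Unshelve. all: by end_near.
Qed.
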